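(* Let $K_1, K_2$ be ordered simplicial complexes and let $f : K_1 \to K_2$ be a weak simplicial morphism. Then $f$ is a weak path morphism if and only if $f$ is a triangle-collapsing simplicial morphism. Consequently, the category $\mathbf{TcOSC}$ is the full subcategory of $\mathbf{WkRPC}$ whose objects are all ordered simplicial complexes.
   Context: Let $V$ be an arbitrary set (the vertices). An elementary $k$-path on $V$ is a sequence $v_0\dots v_k$ of $k+1$ elements of $V$. It is irregular if $v_i=v_{i+1}$ for some $i$, and regular otherwise; it is simplicial if all $v_i$ are distinct. For a function $f:V\to W$ write $f(v_0\dots v_k)=f(v_0)\dots f(v_k)$. A path complex on $V$ is a set $P$ of elementary paths on $V$ containing all singletons $v_0$ ($v_0\in V$) and such that $v_0\dots v_k\in P$ implies $v_1\dots v_k\in P$ and $v_0\dots v_{k-1}\in P$; write $V(P)=V$. It is regular if all its paths are regular. An ordered simplicial complex on $V$ is a set $K$ of simplicial paths on $V$ containing all singletons and closed under deleting any one vertex from a path (ordered subsets); write $V(K)=V$. Every ordered simplicial complex is a regular path complex. For path complexes $P_1,P_2$, a map $f:V(P_1)\to V(P_2)$ is a weak path morphism if for every $p\in P_1$, $f(p)$ is either irregular or belongs to $P_2$. For ordered simplicial complexes $K_1,K_2$, a map $f:V(K_1)\to V(K_2)$ is a weak simplicial morphism if for every $p\in K_1$, $f(p)$ is either non-simplicial or belongs to $K_2$; it is a triangle-collapsing simplicial morphism if it is a weak simplicial morphism and, whenever $v_0v_1v_2\in K_1$ and $f(v_0)=f(v_2)$, then $f(v_0)=f(v_1)=f(v_2)$.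 $\mathbf{WkRPC}$ is the category of regular path complexes with weak path morphisms; $\mathbf{TcOSC}$ is the category of ordered simplicial complexes with triangle-collapsing simplicial morphisms. *)

(* Defs.v *)
From mathcomp Require Import all_boot.
From mathcomp Require Import boolp.

Set Implicit Arguments.
Unset Strict Implicit.
Unset Printing Implicit Defensive.

(* An elementary k-path v_0 ... v_k has k+1 vertices; in particular it is
   never empty. *)
Definition epath (V : Type) (k : nat) : Type := k.+1.-tuple V.

Section ElementaryPaths.
Variables (V W : Type).

Definition irregular k (v : epath V k) : Prop :=
  exists i j : 'I_k.+1, j = i.+1 :> nat /\ tnth v i = tnth v j.

Definition regular k (v : epath V k) : Prop := ~ irregular v.

Definition simplicial k (v : epath V k) : Prop := injective (tnth v).

Definition delete k (i : 'I_k.+2) (v : epath V k.+1) : epath V k :=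
  [tuple tnth v (lift i j) | j < k.+1].

Definition path_image (f : V -> W) k (v : epath V k) : epath W k :=
  map_tuple f v.

End ElementaryPaths.

Record pathset := PathSet {
  vertices : Type;
  mem_paths : forall k, epath vertices k -> Prop
}.

Arguments mem_paths P [k] v : rename.

Definition contains_singletons (P : pathset) : Prop :=
  forall v : vertices P, mem_paths P (k := 0) [tuple v].

Definition path_complex (P : pathset) : Prop :=
  contains_singletons P /\
  forall k (v : epath (vertices P) k.+1), mem_paths P v ->
    mem_paths P (delete ord0 v) /\ mem_paths P (delete ord_max v).

Definition regular_path_complex (P : pathset) : Prop :=
  path_complex P /\
  forall k (v : epath (vertices P) k), mem_paths P v -> regular v.

Definition ordered_simplicial_complex (K : pathset) : Prop :=
  [/\ forall k (v : epath (vertices K) k), mem_paths K v -> simplicial v,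
      contains_singletons K
    & forall k (i : 'I_k.+2) (v : epath (vertices K) k.+1),
        mem_paths K v -> mem_paths K (delete i v)].

Definition weak_path_morphism (P1 P2 : pathset)
    (f : vertices P1 -> vertices P2) : Prop :=
  forall k (p : epath (vertices P1) k), mem_paths P1 p ->
    irregular (path_image f p) \/ mem_paths P2 (path_image f p).

Definition weak_simplicial_morphism (K1 K2 : pathset)
    (f : vertices K1 -> vertices K2) : Prop :=
  forall k (p : epath (vertices K1) k), mem_paths K1 p ->
    ~ simplicial (path_image f p) \/ mem_paths K2 (path_image f p).

Definition triangle_collapsing_morphism (K1 K2 : pathset)
    (f : vertices K1 -> vertices K2) : Prop :=
  weak_simplicial_morphism f /\
  forall v0 v1 v2 : vertices K1,
    mem_paths K1 (k := 2) [tuple v0; v1; v2] -> f v0 = f v2 ->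
    f v0 = f v1 /\ f v1 = f v2.

Section MorphismLemmas.

Lemma irregular_image (V W : Type) (f : V -> W) k (v : epath V k) :
  irregular v -> irregular (path_image f v).
Proof.
by move=> [i [j [ij vij]]]; exists i, j; rewrite !tnth_map vij.
Qed.

Lemma simplicial_image (V W : Type) (f : V -> W) k (v : epath V k) :
  simplicial (path_image f v) -> simplicial v.
Proof. by move=> fv i j vij; apply: fv; rewrite !tnth_map vij. Qed.

Lemma simplicial_regular (V : Type) k (v : epath V k) :
  simplicial v -> regular v.
Proof.
by move=> sv [i [j [ij /sv eij]]]; move: ij; rewrite eij => /n_Sn.
Qed.

Lemma path_image_id (V : Type) k (v : epath V k) : path_image id v = v.
Proof. by apply: eq_from_tnth => i; rewrite tnth_map. Qed.

Lemma path_image_comp (U V W : Type) (g : V -> W) (f : U -> V) k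
    (v : epath U k) :
  path_image (g \o f) v = path_image g (path_image f v).
Proof. by apply: eq_from_tnth => i; rewrite !tnth_map. Qed.

Lemma osc_regular_path_complex K :
  ordered_simplicial_complex K -> regular_path_complex K.
Proof.
move=> [Ks K0 Kd]; split; first by split=> // k v Kv; split; apply: Kd.
by move=> k v /Ks; apply: simplicial_regular.
Qed.

Lemma weak_path_id P : @weak_path_morphism P P id.
Proof. by move=> k p Pp; right; rewrite path_image_id. Qed.

Lemma weak_path_comp P1 P2 P3 (f : vertices P1 -> vertices P2)
    (g : vertices P2 -> vertices P3) :
  weak_path_morphism f -> weak_path_morphism g -> weak_path_morphism (g \o f).
Proof.
move=> wf wg k p /wf; rewrite path_image_comp => -[/irregular_image|/wg//].
by left.
Qed.

Lemma triangle_collapsing_id K :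
  ordered_simplicial_complex K -> @triangle_collapsing_morphism K K id.
Proof.
move=> [Ks _ _]; split; first by move=> k p Kp; right; rewrite path_image_id.
move=> v0 v1 v2 /Ks Kv e02.
by have := Kv (inord 0) (inord 2); rewrite !(tnth_nth v0) !inordK //=;
  move=> /(_ e02) /(congr1 val); rewrite /= !inordK.
Qed.

Lemma path_image_triple (V W : Type) (f : V -> W) v0 v1 v2 :
  path_image f ([tuple v0; v1; v2] : epath V 2) = [tuple f v0; f v1; f v2].
Proof. exact: val_inj. Qed.

Lemma simplicial_triple (V : Type) (v0 v1 v2 : V) :
  v0 <> v1 -> v1 <> v2 -> v0 <> v2 ->
  simplicial ([tuple v0; v1; v2] : epath V 2).
Proof.
move=> n01 n12 n02 [[|[|[|//]]] i3] [[|[|[|//]]] j3];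
  rewrite !(tnth_nth v0) /= => e; by [exact: val_inj | case: n01 | case: n12
  | case: n02 ].
Qed.

Lemma triangle_collapsing_comp K1 K2 K3 (f : vertices K1 -> vertices K2)
    (g : vertices K2 -> vertices K3) :
  triangle_collapsing_morphism f -> triangle_collapsing_morphism g ->
  triangle_collapsing_morphism (g \o f).
Proof.
move=> [wf tf] [wg tg]; split.
  move=> k p /wf; rewrite path_image_comp => -[nsf|/wg//].
  by left=> /simplicial_image.
move=> v0 v1 v2 Kv /= e02.
have [e01|n01] := pselect (f v0 = f v1); first by rewrite -e02 e01.
have [e12|n12] := pselect (f v1 = f v2); first by rewrite e02 e12.
have [f02|n02] := pselect (f v0 = f v2); first by case: (tf _ _ _ Kv f02).
have := wf _ _ Kv; rewrite path_image_triple => -[[]|Kfv].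
  exact: simplicial_triple.
exact: tg Kfv e02.
Qed.

End MorphismLemmas.

Record category := Category {
  obj :> Type;
  hom : obj -> obj -> Type;
  idm : forall a, hom a a;
  comp : forall a b c, hom b c -> hom a b -> hom a c;
  comp_idl : forall a b (f : hom a b), comp (idm b) f = f;
  comp_idr : forall a b (f : hom a b), comp f (idm a) = f;
  comp_assoc : forall a b c d (h : hom c d) (g : hom b c) (f : hom a b),
    comp h (comp g f) = comp (comp h g) f
}.

Arguments hom {c} a b : rename.
Arguments idm {c} a : rename.
Arguments comp {c a b c0} g f : rename.

Definition functor_laws (D C : category) (F0 : D -> C)
    (F1 : forall a b : D, hom a b -> hom (F0 a) (F0 b)) : Prop :=
  (forall a, F1 a a (idm a) = idm (F0 a)) /\
  (forall a b c (g : hom b c) (f : hom a b),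
     F1 a c (comp g f) = comp (F1 b c g) (F1 a b f)).

(* (F0, F1) embeds D in C as the full subcategory whose objects are exactly
   those satisfying Q: it identifies the objects of D with the objects of C in
   Q, and each hom-set of D with the corresponding hom-set of C. *)
Definition full_subcategory_inclusion (D C : category) (Q : C -> Prop)
    (F0 : D -> C) (F1 : forall a b : D, hom a b -> hom (F0 a) (F0 b)) : Prop :=
  [/\ functor_laws F1,
      injective F0,
      forall c : C, Q c <-> exists d : D, F0 d = c
    & forall a b : D, bijective (F1 a b)].

Definition regular_pc := {P : pathset | regular_path_complex P}.
Definition osc := {K : pathset | ordered_simplicial_complex K}.

Definition wk_mor (P1 P2 : regular_pc) :=
  {f : vertices (sval P1) -> vertices (sval P2) | weak_path_morphism f}.
Definition wk_id (P : regular_pc) : wk_mor P P :=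
  exist _ id (@weak_path_id (sval P)).
Definition wk_comp (P1 P2 P3 : regular_pc)
    (g : wk_mor P2 P3) (f : wk_mor P1 P2) : wk_mor P1 P3 :=
  exist _ (sval g \o sval f) (weak_path_comp (svalP f) (svalP g)).

Definition tc_mor (K1 K2 : osc) :=
  {f : vertices (sval K1) -> vertices (sval K2) |
    triangle_collapsing_morphism f}.
Definition tc_id (K : osc) : tc_mor K K :=
  exist _ id (triangle_collapsing_id (svalP K)).
Definition tc_comp (K1 K2 K3 : osc)
    (g : tc_mor K2 K3) (f : tc_mor K1 K2) : tc_mor K1 K3 :=
  exist _ (sval g \o sval f) (triangle_collapsing_comp (svalP f) (svalP g)).

Lemma wk_comp_idl P1 P2 (f : wk_mor P1 P2) : wk_comp (wk_id P2) f = f.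
Proof. by case: f => f wf; apply: eq_exist. Qed.

Lemma wk_comp_idr P1 P2 (f : wk_mor P1 P2) : wk_comp f (wk_id P1) = f.
Proof. by case: f => f wf; apply: eq_exist. Qed.

Lemma wk_comp_assoc P1 P2 P3 P4 (h : wk_mor P3 P4) (g : wk_mor P2 P3)
    (f : wk_mor P1 P2) :
  wk_comp h (wk_comp g f) = wk_comp (wk_comp h g) f.
Proof. exact: eq_exist. Qed.

Lemma tc_comp_idl K1 K2 (f : tc_mor K1 K2) : tc_comp (tc_id K2) f = f.
Proof. by case: f => f tf; apply: eq_exist. Qed.

Lemma tc_comp_idr K1 K2 (f : tc_mor K1 K2) : tc_comp f (tc_id K1) = f.
Proof. by case: f => f tf; apply: eq_exist. Qed.

Lemma tc_comp_assoc K1 K2 K3 K4 (h : tc_mor K3 K4) (g : tc_mor K2 K3)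
    (f : tc_mor K1 K2) :
  tc_comp h (tc_comp g f) = tc_comp (tc_comp h g) f.
Proof. exact: eq_exist. Qed.

Definition WkRPC : category :=
  @Category regular_pc wk_mor wk_id wk_comp
    wk_comp_idl wk_comp_idr wk_comp_assoc.

Definition TcOSC : category :=
  @Category osc tc_mor tc_id tc_comp
    tc_comp_idl tc_comp_idr tc_comp_assoc.

Definition osc_to_rpc (K : TcOSC) : WkRPC :=
  exist _ (sval K) (osc_regular_path_complex (svalP K)).

(* Main.v *)
Require Import Defs.
From mathcomp Require Import all_boot.
From mathcomp Require Import boolp.

(** Let [f] be a map between ordered simplicial complexes.

    If [f] is a weak path morphism and identifies the ends of a triangle
    [v0 v1 v2], the image of the triangle is not simplicial, hence not in the
    target; it must then be irregular, which collapses the whole triangle.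

    Conversely, let [f] be triangle-collapsing and suppose that the image of a
    path [p] is not simplicial, say [f] identifies the vertices of [p] at two
    positions [i < j].  An ordered simplicial complex contains all subpaths of
    its paths ([subpath_closed]), in particular the triangle at the positions
    [i], [i + 1], [j].  Collapsing it identifies two *consecutive* vertices, so
    the image of [p] is irregular ([collapse_irregular]).

    A weak path morphism into an ordered simplicial complex is moreover weakly
    simplicial, since irregular paths are not simplicial.  Hence both notions
    of morphism are the same property of the underlying map
    ([weak_path_iff_triangle_collapsing]), and the assertion on categories
    reduces to rewrapping the same map with another proof. *)

Set Implicit Arguments.
Unset Strict Implicit.
Unset Printing Implicit Defensive.

Lemma increasing_inj m n (h : 'I_m -> 'I_n) :
  {homo h : i j / i < j} -> injective h.
Proof.
move=> h_inc i j hij; apply/val_inj/eqP; rewrite eqn_leq.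
by apply/andP; split; rewrite leqNgt; apply/negP => /h_inc; rewrite hij ltnn.
Qed.

Lemma increasing_endo_id n (h : 'I_n -> 'I_n) :
  {homo h : i j / i < j} -> h =1 id.
Proof.
move=> h_inc; have h_inj := increasing_inj h_inc.
(* The values of [h] in order and the enumeration of ['I_n] are strictly sorted
   lists with the same elements. *)
have ltr : transitive (fun i j : 'I_n => i < j).
  by move=> ? ? ?; apply: ltn_trans.
have enum_sorted : sorted (fun i j : 'I_n => i < j) (enum 'I_n).
  have := iota_ltn_sorted 0 n.
  by rewrite -val_enum_ord sorted_map.
have : codom h = enum 'I_n.
  apply: (irr_sorted_eq ltr) => //; first by move=> i; apply: ltnn.
    by rewrite codomE; apply: homo_sorted enum_sorted.
  move=> i; rewrite mem_enum; apply/codomP.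
  by exists (invF h_inj i); rewrite f_invF.
rewrite codomE -[RHS]map_id => /eq_in_map eq_h i.
by apply: eq_h; rewrite mem_enum.
Qed.

(** Deleting one vertex at a time reaches every subpath: a proper selection [h]
    of positions misses one of them, so it factors through the deletion of that
    position. *)
Lemma subpath_closed (K : pathset) k m (v : epath (vertices K) k)
    (h : 'I_m.+1 -> 'I_k.+1) :
  ordered_simplicial_complex K -> {homo h : i j / i < j} ->
  mem_paths K v -> mem_paths K (k := m) [tuple tnth v (h j) | j < m.+1].
Proof.
case=> [_ _ Kdel] h_inc Kv.
have le_mk : m <= k.
  by have := leq_card h (increasing_inj h_inc); rewrite !card_ord ltnS.
elim: k => [|k IHk] in v h h_inc Kv le_mk *; move: (le_mk);
  rewrite leq_eqVlt => /predU1P[eq_mk|//].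
1,2: subst m; rewrite (_ : [tuple _ | _ < _] = v) //;
     by apply: eq_from_tnth => i; rewrite tnth_mktuple increasing_endo_id.
rewrite ltnS => lt_mk.
have [i i_missed] : exists i, i \notin codom h.
  apply/existsP; rewrite -negb_forall; apply/negP => /forallP h_onto.
  have := leq_image_card h predT; rewrite (eq_card (B := predT)) //.
  by rewrite !card_ord ltnS leqNgt ltnS lt_mk.
have h_lift j : exists l, h j == lift i l.
  have [l ->|hj] := unliftP i (h j); first by exists l.
  by rewrite -hj codom_f in i_missed.
pose h' j := xchoose (h_lift j).
have h'E j : h j = lift i (h' j) by apply/eqP/(xchooseP (h_lift j)).
have h'_inc : {homo h' : j l / j < l}.
  by move=> j l /h_inc; rewrite !h'E !ltnNge /= leq_bump2.
have := IHk _ h' h'_inc (Kdel _ i _ Kv) lt_mk.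
congr (mem_paths K _); apply: eq_from_tnth => j.
by rewrite !tnth_mktuple h'E.
Qed.

(** An identification of two vertices of a path propagates to two consecutive
    ones, through the triangle formed with the successor of the first. *)
Lemma collapse_irregular (K1 K2 : pathset) (f : vertices K1 -> vertices K2) k
    (p : epath (vertices K1) k) (i j : 'I_k.+1) :
  ordered_simplicial_complex K1 -> triangle_collapsing_morphism f ->
  mem_paths K1 p -> i < j -> f (tnth p i) = f (tnth p j) ->
  irregular (path_image f p).
Proof.
move=> K1osc [_ f_tri] K1p lt_ij fij.
have lt_i1k : i.+1 < k.+1 by apply: leq_ltn_trans lt_ij _.
pose i1 := Ordinal lt_i1k.
exists i, i1; split=> //; rewrite !tnth_map.
move: (lt_ij); rewrite leq_eqVlt => /predU1P[eq_j|lt_i1j].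
  by rewrite fij; congr (f (tnth p _)); apply: val_inj.
pose h := tnth [tuple i; i1; j].
have h_inc : {homo h : a b / a < b}.
  by move=> [[|[|[|//]]] a3] [[|[|[|//]]] b3];
    rewrite /h !(tnth_nth i) //= => _.
have := subpath_closed K1osc h_inc K1p.
rewrite (_ : [tuple _ | _ < _] = [tuple tnth p i; tnth p i1; tnth p j]).
  by case/f_tri.
rewrite (_ : [tuple _; _; _] = map_tuple (tnth p) [tuple i; i1; j]);
  last exact: val_inj.
by apply: eq_from_tnth => a; rewrite tnth_mktuple tnth_map.
Qed.

Lemma weak_path_simplicial (K1 K2 : pathset) (f : vertices K1 -> vertices K2) :
  weak_path_morphism f -> weak_simplicial_morphism f.
Proof.
move=> wf k p /wf[irr|]; last by right.
by left=> /simplicial_regular; apply.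
Qed.

Lemma weak_path_iff_triangle_collapsing (K1 K2 : pathset)
    (f : vertices K1 -> vertices K2) :
  ordered_simplicial_complex K1 -> ordered_simplicial_complex K2 ->
  weak_path_morphism f <-> triangle_collapsing_morphism f.
Proof.
move=> K1osc [K2simp _ _]; split=> [wf|tf].
  split=> [|v0 v1 v2 /wf + f02]; first exact: weak_path_simplicial.
  rewrite path_image_triple => -[|/K2simp f_simp].
    move=> [[[|[|[|//]]] a3] [[[|[|[|//]]] b3] []]] //= _;
      by rewrite !(tnth_nth (f v0)) /= => e; split; congruence.
  by have := f_simp ord0 ord_max; rewrite !(tnth_nth (f v0)) => /(_ f02).
move=> k p K1p; have [|f_nsimp] := tf.1 k p K1p; last by right.
move=> f_nsimp; left; apply: contrapT => f_reg; apply: f_nsimp => i j.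
rewrite !tnth_map => fij; apply: contrapT => /eqP; rewrite neq_ltn.
by case/orP=> lt; apply: f_reg; apply: collapse_irregular lt _.
Qed.

Theorem lemma2p10 :
  (forall (K1 K2 : pathset) (f : vertices K1 -> vertices K2),
     ordered_simplicial_complex K1 -> ordered_simplicial_complex K2 ->
     weak_simplicial_morphism f ->
     (weak_path_morphism f <-> triangle_collapsing_morphism f)) /\
  (exists F1 : forall K1 K2 : TcOSC,
       hom K1 K2 -> hom (osc_to_rpc K1) (osc_to_rpc K2),
     (forall (K1 K2 : TcOSC) (f : hom K1 K2), sval (F1 K1 K2 f) = sval f) /\
     full_subcategory_inclusion
       (fun P : WkRPC => ordered_simplicial_complex (sval P)) F1).
Proof.
split=> [K1 K2 f K1osc K2osc _|].
  exact: weak_path_iff_triangle_collapsing.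
have iffK (K1 K2 : osc) (f : vertices (sval K1) -> vertices (sval K2)) :=
  weak_path_iff_triangle_collapsing f (svalP K1) (svalP K2).
pose F1 (K1 K2 : TcOSC) (f : hom K1 K2) :
    hom (osc_to_rpc K1) (osc_to_rpc K2) :=
  exist _ (sval f) ((iffK K1 K2 (sval f)).2 (svalP f)).
exists F1; split=> //; split.
- by split=> *; apply: eq_exist.
- by move=> [K Kosc] [L Losc] /(congr1 sval) /= eqKL; apply: eq_exist.
- move=> [P Prpc]; split=> /= [Posc|[[K Kosc] /(congr1 sval) /= <- //]].
  by exists (exist _ P Posc); apply: eq_exist.
- move=> K1 K2.
  exists (fun g => exist _ (sval g) ((iffK K1 K2 (sval g)).1 (svalP g))).
  + by case=> f tf; apply: eq_exist.
  + by case=> f wf; apply: eq_exist.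
Qed.
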